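(* Let $A\in\{\mathbb{C},\mathbb{H},\mathbb{O}\}$, let $\Omega\subseteq A$ be a circular set, let $f\in\mathcal{S}(\Omega)$ and suppose that $\Omega':=\Omega\setminus V(N(f))$ is not empty. For all $x\in\Omega'\setminus\mathbb{R}$, $$f^{-\bullet}(x)=\Phi\big(f_s^\circ(x),|\operatorname{im}(x)|\,f'_s(x)\big)-\frac{\operatorname{im}(x)}{|\operatorname{im}(x)|}\,\Phi\big(|\operatorname{im}(x)|\,f'_s(x),f_s^\circ(x)\big),$$ where the first summand equals $(f^{-\bullet})_s^\circ(x)$ and the second summand (with its sign) equals $\operatorname{im}(x)\,(f^{-\bullet})'_s(x)$. For all $x\in\Omega'\cap(\mathbb{R}\cup V(f'_s))$, $f^{-\bullet}(x)=f_s^\circ(x)^{-1}=f(x)^{-1}$. Moreover, $V((f^{-\bullet})'_s)=V(f'_s)\cap\Omega'$.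
   Context: $A$ is one of the real $*$-algebras $\mathbb{C},\mathbb{H},\mathbb{O}$ (complex numbers, quaternions, octonions) with standard conjugation $x\mapsto x^c$; $t(x)=x+x^c$, $n(x)=xx^c=|x|^2$, $\operatorname{im}(x)=(x-x^c)/2$; $\mathbb{S}=\{w\in A: w^2=-1\}$. For $a,b\in A$ with $n(a)\neq n(b)$ or $t(b^ca)\neq0$, $$\Phi(a,b):=\frac{n(a)a^c+b^cab^c}{(n(a)-n(b))^2+(t(b^ca))^2}.$$ For nonempty $D\subseteq\mathbb{C}$ invariant under complex conjugation, $\Omega_D=\{\alpha+\beta J:\alpha,\beta\in\mathbb{R},\,J\in\mathbb{S},\,\alpha+i\beta\in D\}$; sets of this form are called circular. Let $\Omega=\Omega_D$. A function $f:\Omega\to A$ is a slice function if there are $F_1,F_2:D\to A$ with $F_1(\bar z)=F_1(z)$, $F_2(\bar z)=-F_2(z)$ and $f(\alpha+\beta J)=F_1(\alpha+i\beta)+JF_2(\alpha+i\beta)$ for all $\alpha+i\beta\in D$, $J\in\mathbb{S}$ ($F_1,F_2$ are determined by $f$). $\mathcal{S}(\Omega)$ is the set of slice functions on $\Omega$. If $f,g$ correspond to $(F_1,F_2),(G_1,G_2)$, the slice product $f\cdot g$ corresponds to $(F_1G_1-F_2G_2,\;F_1G_2+F_2G_1)$ and the slice conjugate $f^c$ corresponds to $(F_1^c,F_2^c)$. The normal function is $N(f)=f\cdot f^c$. $V(h)$ denotes the zero set of $h$ in its domain. The reciprocal $f^{-\bullet}\in\mathcal{S}(\Omega')$ is the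 multiplicative inverse of $f_{|\Omega'}$ with respect to the slice product; it exists and equals $f^{-\bullet}(x)=(N(f)(x))^{-1}f^c(x)$. The spherical value $f_s^\circ:\Omega\to A$ and spherical derivative $f'_s:\Omega\setminus\mathbb{R}\to A$ are $f_s^\circ(x)=\frac12(f(x)+f(x^c))$, $f'_s(x)=\frac12\operatorname{im}(x)^{-1}(f(x)-f(x^c))$; thus $V(f'_s)\subseteq\Omega\setminus\mathbb{R}$, and similarly for $f^{-\bullet}$ on $\Omega'$. *)

(* Defs.v *)
From HB Require Import structures.
From mathcomp Require Import all_boot all_order all_algebra.
From mathcomp Require Import boolp classical_sets functions reals.
From mathcomp Require Import complex.
From mathcomp Require Import ring lra.

Set Implicit Arguments.
Unset Strict Implicit.
Unset Printing Implicit Defensive.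
Import Order.TTheory GRing.Theory Num.Theory.

Local Open Scope ring_scope.
Local Open Scope complex_scope.
Local Open Scope classical_set_scope.

(* The raw operations of a real, not necessarily associative, *-algebra; [sre]
   is the real part, used to read off an element of [R * 1] as a real number. *)
Record star_alg (R : realType) := StarAlg {
  scar :> lmodType R;
  sone : scar;
  smul : scar -> scar -> scar;
  sconj : scar -> scar;
  sre : scar -> R }.

Arguments sone {R s}.
Arguments smul {R s} x y.
Arguments sconj {R s} x.
Arguments sre {R s} x.

Notation "x *a y" := (smul x y) (at level 40, left associativity).

(* [Rcomplex R] is [R[i]] with its structure of R-vector space. *)
Definition complex_alg (R : realType) : star_alg R :=
  @StarAlg R (Rcomplex R) (1 : R[i])
    (fun x y => (x : R[i]) * (y : R[i])) (fun x => conjc (x : R[i]))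
    (fun x => complex.Re x).

Definition cayley_dickson (R : realType) (B : star_alg R) : star_alg R :=
  @StarAlg R (scar B * scar B)%type (sone, 0)
    (fun x y => (x.1 *a y.1 - sconj y.2 *a x.2, y.2 *a x.1 + x.2 *a sconj y.1))
    (fun x => (sconj x.1, - x.2)) (fun x => sre x.1).

Variant alg_kind := Complexes | Quaternions | Octonions.

Definition alg (R : realType) (k : alg_kind) : star_alg R :=
  match k with
  | Complexes => complex_alg R
  | Quaternions => cayley_dickson (complex_alg R)
  | Octonions => cayley_dickson (cayley_dickson (complex_alg R))
  end.

Section StarAlgebra.
Variables (R : realType) (A : star_alg R).
Implicit Types (x a b : A).

(* [tr x] and [nrm x] are the real numbers [x + x^c] and [x x^c]:
   see [add_sconj] and [mul_sconj]. *)
Definition tr x : R := sre (x + sconj x).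
Definition nrm x : R := sre (x *a sconj x).
Definition absA x : R := Num.sqrt (nrm x).
Definition im x : A := 2^-1 *: (x - sconj x).

(* The inverse of x <> 0: see [mulAV] and [mulVA]. *)
Definition invA x : A := (nrm x)^-1 *: sconj x.

Definition realA : set A := [set x | exists r : R, x = r *: sone].

(* The imaginary units *)
Definition sphere : set A := [set w | w *a w = - sone].

Definition Phi_dom a b : Prop := nrm a != nrm b \/ tr (sconj b *a a) != 0.

Definition Phi a b : A :=
  ((nrm a - nrm b) ^+ 2 + tr (sconj b *a a) ^+ 2)^-1 *:
    (nrm a *: sconj a + (sconj b *a a) *a sconj b).

Definition conj_invariant (D : set R[i]) : Prop := forall z, D z -> D (conjc z).

Definition circ (D : set R[i]) : set A :=
  [set x | exists al be : R, exists J : A,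
     [/\ sphere J, D (al +i* be) & x = al *: sone + be *: J]].

Definition circular (Om : set A) : Prop :=
  exists D, [/\ D !=set0, conj_invariant D & Om = circ D].

(* The set D with Omega = Omega_D : see [profile_circ] *)
Definition profile (Om : set A) : set R[i] :=
  [set z | exists2 J : A, sphere J & Om (complex.Re z *: sone + complex.Im z *: J)].

(* Functions on a subset of A (or of R[i]) are represented by total functions,
   whose values outside of the subset are irrelevant. *)
Definition stem_type : Type := ((R[i] -> A) * (R[i] -> A))%type.

Definition is_stem (D : set R[i]) (F : stem_type) : Prop :=
  forall z, D z -> F.1 (conjc z) = F.1 z /\ F.2 (conjc z) = - F.2 z.

Definition corresponds (D : set R[i]) (F : stem_type) (f : A -> A) : Prop :=
  is_stem D F /\
  forall (al be : R) (J : A), sphere J -> D (al +i* be) ->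
    f (al *: sone + be *: J) = F.1 (al +i* be) + J *a F.2 (al +i* be).

(* f (restricted to Omega) belongs to S(Omega) *)
Definition slice (Om : set A) (f : A -> A) : Prop :=
  circular Om /\ exists F, corresponds (profile Om) F f.

(* The pair (F1, F2) of a slice function, unique on the profile of Omega:
   see [stemP] and [corresponds_inj] *)
Definition stem (Om : set A) (f : A -> A) : stem_type :=
  xget (fun=> 0, fun=> 0) [set F | corresponds (profile Om) F f].

(* The slice function of a pair (F1, F2): see [induceP]. When x is real, its
   second summand vanishes, as the corresponding F2 (alpha) does. *)
Definition induce (F : stem_type) (x : A) : A :=
  F.1 (sre x +i* absA (im x))
  + ((absA (im x))^-1 *: im x) *a F.2 (sre x +i* absA (im x)).

Definition stem_mul (F G : stem_type) : stem_type :=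
  (fun z => F.1 z *a G.1 z - F.2 z *a G.2 z,
   fun z => F.1 z *a G.2 z + F.2 z *a G.1 z).

Definition stem_conj (F : stem_type) : stem_type :=
  (fun z => sconj (F.1 z), fun z => sconj (F.2 z)).

Definition slice_mul (Om : set A) (f g : A -> A) : A -> A :=
  induce (stem_mul (stem Om f) (stem Om g)).

Definition slice_conj (Om : set A) (f : A -> A) : A -> A :=
  induce (stem_conj (stem Om f)).

Definition normal (Om : set A) (f : A -> A) : A -> A :=
  slice_mul Om f (slice_conj Om f).

Definition zeros (Om : set A) (h : A -> A) : set A := [set x | Om x /\ h x = 0].

(* g is the inverse of f restricted to Omega for the slice product *)
Definition slice_inverse (Om : set A) (f g : A -> A) : Prop :=
  slice Om g /\
  forall x, Om x -> slice_mul Om f g x = sone /\ slice_mul Om g f x = sone.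

Definition sph_value (f : A -> A) (x : A) : A := 2^-1 *: (f x + f (sconj x)).

Definition sph_deriv (f : A -> A) (x : A) : A :=
  2^-1 *: (invA (im x) *a (f x - f (sconj x))).

End StarAlgebra.

Arguments realA {R A}.
Arguments sphere {R A}.

(* Closes an identity between polynomial expressions in elements of [alg R k]
   by comparing real coordinates. *)
Ltac alg_coord :=
  simpl in *; rewrite ?/nrm ?/tr ?/im /=;
  repeat match goal with
  | x : prod _ _ |- _ => destruct x
  | x : Rcomplex _ |- _ => destruct x
  | x : complex _ |- _ => destruct x
  end;
  rewrite /=; repeat congr pair; repeat congr Complex; rewrite /=.

Section Facts.
Variables (R : realType) (k : alg_kind).
Implicit Types (x y z J : alg R k) (r s : R) (f : alg R k -> alg R k).

Lemma add_sconj x : x + sconj x = tr x *: sone.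
Proof. by case: k x => x; alg_coord; ring. Qed.

Lemma mul_sconj x : x *a sconj x = nrm x *: sone.
Proof. by case: k x => x; alg_coord; ring. Qed.

Lemma mul_sconjl x : sconj x *a x = nrm x *: sone.
Proof. by case: k x => x; alg_coord; ring. Qed.

Lemma smulZl r x y : (r *: x) *a y = r *: (x *a y).
Proof. by case: k x y => x y; alg_coord; ring. Qed.

Lemma smulZr r x y : x *a (r *: y) = r *: (x *a y).
Proof. by case: k x y => x y; alg_coord; ring. Qed.

Lemma smulDl x y z : (x + y) *a z = x *a z + y *a z.
Proof. by case: k x y z => x y z; alg_coord; ring. Qed.

Lemma smulDr x y z : x *a (y + z) = x *a y + x *a z.
Proof. by case: k x y z => x y z; alg_coord; ring. Qed.

Lemma smul_altl x y : x *a (x *a y) = (x *a x) *a y.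
Proof. by case: k x y => x y; alg_coord; ring. Qed.

Lemma smul_altr x y : (y *a x) *a x = y *a (x *a x).
Proof. by case: k x y => x y; alg_coord; ring. Qed.

Lemma smulA_quaternions (a b c : alg R Quaternions) :
  a *a (b *a c) = (a *a b) *a c.
Proof. by alg_coord; ring. Qed.

Lemma nrmM x y : nrm (x *a y) = nrm x * nrm y.
Proof. by case: k x y => x y; alg_coord; ring. Qed.

Lemma smul1l x : sone *a x = x.
Proof. by case: k x => x; alg_coord; ring. Qed.

Lemma sone_neq0 : (sone : alg R k) != 0.
Proof.
suff: sre (sone : alg R k) != sre (0 : alg R k) by apply: contra_neq => ->.
by case: k; rewrite /= oner_neq0.
Qed.

Lemma sreZ r x : sre (r *: x) = r * sre x.
Proof. by case: k x => x; alg_coord. Qed.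

Lemma sreD x y : sre (x + y) = sre x + sre y.
Proof. by case: k x y => x y; alg_coord. Qed.

Lemma sre1 : sre (sone : alg R k) = 1.
Proof. by case: k. Qed.

Lemma nrmZ r x : nrm (r *: x) = r ^+ 2 * nrm x.
Proof. by case: k x => x; alg_coord; ring. Qed.

Lemma nrm_ge0 x : 0 <= nrm x.
Proof. by case: k x => x; alg_coord; nra. Qed.

Lemma nrm_eq0 x : (nrm x == 0) = (x == 0).
Proof.
apply/eqP/eqP => [|->]; last by case: k; rewrite /nrm /=; ring.
by case: k x => x; alg_coord => n0; do ?[congr pair]; congr Complex; nra.
Qed.

Lemma mulAV x : x != 0 -> x *a invA x = sone.
Proof.
by rewrite -nrm_eq0 => x0; rewrite smulZr mul_sconj scalerA mulVf ?scale1r.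
Qed.

Lemma mulVA x : x != 0 -> invA x *a x = sone.
Proof.
by rewrite -nrm_eq0 => x0; rewrite smulZl mul_sconjl scalerA mulVf ?scale1r.
Qed.

Lemma im_sre x : x = sre x *: sone + im x.
Proof. by case: k x => x; alg_coord; field. Qed.

Lemma sqr_im x : im x *a im x = - (nrm (im x) *: sone).
Proof. by case: k x => x; alg_coord; field. Qed.

Lemma sqrE x : x *a x = (2 * sre x) *: x - nrm x *: sone.
Proof. by case: k x => x; alg_coord; ring. Qed.

Lemma sphereP J : sphere J <-> sre J = 0 /\ nrm J = 1.
Proof.
rewrite /sphere /=; split=> [JJ|[J0 J1]]; last first.
  by rewrite sqrE J0 J1 mulr0 scale0r scale1r sub0r.
have nJ : nrm J = 1.
  have : nrm (J *a J) = 1 by rewrite JJ -scaleN1r nrmZ -[X in _ * X]mulr1;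
    case: k; rewrite /nrm /=; ring.
  rewrite nrmM => /eqP; have := nrm_ge0 J; nra.
split=> //; have := sqrE J; rewrite JJ nJ scale1r => /eqP.
rewrite eq_sym -subr_eq0 opprK subrK scaler_eq0 mulf_eq0 pnatr_eq0 /=.
case/orP => [/eqP//|/eqP J0].
by move: nJ; rewrite J0 -(scale0r J) nrmZ expr2 !mul0r => /eqP;
  rewrite eq_sym oner_eq0.
Qed.

Lemma sphereN J : sphere J -> sphere (- J).
Proof.
by rewrite !sphereP -scaleN1r sreZ nrmZ => -[-> ->]; rewrite mulr0; split=> //; ring.
Qed.

Lemma sphere_neq0 : exists J : alg R k, sphere J.
Proof.
have i2 : ('i%C : R[i]) * 'i%C = -1 by rewrite -expr2 sqr_i.
have e : exists J : alg R k, sre J = 0 /\ nrm J = 1.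
  by case: k; [exists 'i%C|exists ('i%C, 0)|exists (('i%C, 0), 0)];
    rewrite /nrm /=; split=> //; ring.
by case: e => J ?; exists J; apply/sphereP.
Qed.

Lemma im_polar r s J : sphere J ->
  [/\ sre (r *: sone + s *: J) = r, im (r *: sone + s *: J) = s *: J
    & absA (im (r *: sone + s *: J)) = `|s|].
Proof.
move=> /sphereP[J0 J1].
have re : sre (r *: sone + s *: J) = r.
  by rewrite sreD !sreZ sre1 J0 mulr1 mulr0 addr0.
have imE : im (r *: sone + s *: J) = s *: J.
  by have := im_sre (r *: sone + s *: J); rewrite re => /addrI.
by rewrite imE /absA nrmZ J1 mulr1 sqrtr_sqr.
Qed.

Lemma profile_circ (D : set R[i]) :
  conj_invariant D -> profile (@circ R (alg R k) D) = D.
Proof.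
move=> cD; apply/seteqP; split=> -[u v] /=; last first.
  by move=> Duv; have [J SJ] := sphere_neq0; exists J => //; exists u, v, J.
case=> J SJ [a [b [K [SK Dab /esym E]]]].
have [r1 _ n1] := im_polar u v SJ; have [r2 _ n2] := im_polar a b SK.
move: Dab; rewrite -r2 E r1.
have: `|b| = `|v| by rewrite -n1 -n2 E.
move=> /eqP; rewrite eqr_norm2 => /orP[] /eqP -> // /cD.
by rewrite /= opprK.
Qed.

Lemma corresponds_inj (D : set R[i]) (F G : stem_type (alg R k)) f :
  conj_invariant D -> corresponds D F f -> corresponds D G f ->
  forall z : R[i], D z -> F.1 z = G.1 z /\ F.2 z = G.2 z.
Proof.
move=> cD [_ Ff] [_ Gf] [u v] Dz; have [J SJ] := sphere_neq0.
have E1 : F.1 (u +i* v) + J *a F.2 (u +i* v)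
    = G.1 (u +i* v) + J *a G.2 (u +i* v) by rewrite -Ff // Gf.
have NM x : (- J) *a x = - (J *a x) by rewrite -!scaleN1r smulZl.
have E2 : F.1 (u +i* v) - J *a F.2 (u +i* v)
    = G.1 (u +i* v) - J *a G.2 (u +i* v).
  by rewrite -!NM -Ff ?Gf //; exact: sphereN.
have E3 : F.1 (u +i* v) = G.1 (u +i* v).
  apply: (@scalerI R _ 2); first by rewrite pnatr_eq0.
  rewrite !scaler_nat !mulr2n -{1}[F.1 _](addrK (J *a F.2 (u +i* v))).
  by rewrite -addrA [- _ + _]addrC E1 E2 addrACA subrr addr0.
split=> //; move: E1; rewrite E3 => /addrI /(congr1 (smul (- J))).
rewrite !NM !smul_altl => /oppr_inj.
by rewrite (SJ : _ = _) -scaleN1r !smulZl !smul1l !scaleN1r => /oppr_inj.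
Qed.

Lemma stemP (Om : set (alg R k)) f :
  slice Om f -> corresponds (profile Om) (stem Om f) f.
Proof. by move=> [_ exF]; exact: xgetPex exF. Qed.

Lemma induceP (D : set R[i]) (F : stem_type (alg R k)) :
  is_stem D F -> corresponds D F (induce F).
Proof.
move=> sF; split=> // u v J SJ Dz; rewrite /induce.
have [-> -> ->] := im_polar u v SJ; rewrite scalerA.
have [v0|v0|v0] := ltgtP v 0.
- have [/= E1 E2] := sF _ Dz.
  rewrite ltr0_norm // E1 E2 invrN mulNr mulVf ?lt_eqF //.
  by rewrite scaleN1r -!scaleN1r smulZl smulZr scalerA mulrNN mulr1 scale1r.
- by rewrite gtr0_norm // mulVf ?gt_eqF // scale1r.
- have [/= _] := sF _ Dz; rewrite v0 oppr0 => /eqP.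
  rewrite -addr_eq0 -mulr2n -scaler_nat scaler_eq0 pnatr_eq0 /= => /eqP F0.
  rewrite normr0 mulr0 scale0r F0.
  by congr (_ + _); rewrite -(scale0r (0 : alg R k)) !smulZr !scale0r.
Qed.

End Facts.

(* Main.v *)
(* Identify the stem pair (F1, F2) at a point with F = a + i b in the alternative
   algebra A (x) C. Its norm N(F) = F F^c = (n(a) - n(b)) + i t(b^c a) is central,
   so F G = 1 forces N(F) G = F^c (F G) = F^c. As b^c a b^c = t(b^c a) b^c - n(b) a^c,
   the components of N(F)^-1 F^c are Phi(a, b) and -Phi(b, a). Off the real axis
   f_s^o and |im| f'_s are the stem components of f, and likewise for the
   reciprocal. Finally F G = 1 with G = c + i d says a c - b d = 1 and
   a d + b c = 0; as A has no zero divisors, d = 0 if and only if b = 0. *)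
Require Import Defs.
From HB Require Import structures.
From mathcomp Require Import all_boot all_order all_algebra.
From mathcomp Require Import boolp classical_sets functions reals.
From mathcomp Require Import complex.
From mathcomp Require Import ring.

Set Implicit Arguments.
Unset Strict Implicit.
Unset Printing Implicit Defensive.
Import Order.TTheory GRing.Theory Num.Theory.

Local Open Scope ring_scope.
Local Open Scope classical_set_scope.

(** * Identities of the star-algebra [A] *)

Section AlgebraIdentities.
Variables (R : realType) (k : alg_kind).
Implicit Types a b c d x y : alg R k.

Lemma smulNl x y : (- x) *a y = - (x *a y).
Proof. by rewrite -!scaleN1r smulZl. Qed.

Lemma smulNr x y : x *a (- y) = - (x *a y).
Proof. by rewrite -!scaleN1r smulZr. Qed.

Lemma smul0r x : x *a 0 = 0.
Proof. by rewrite -(scale0r x) smulZr !scale0r. Qed.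

Lemma smul0l x : 0 *a x = 0.
Proof. by rewrite -(scale0r x) smulZl !scale0r. Qed.

Lemma sconjD x y : sconj (x + y) = sconj x + sconj y.
Proof. by case: k x y => x y; alg_coord; ring. Qed.

Lemma sconjZ (r : R) x : sconj (r *: x) = r *: sconj x.
Proof. by case: k x => x; alg_coord; ring. Qed.

Lemma sconjN x : sconj (- x) = - sconj x.
Proof. by rewrite -!scaleN1r sconjZ. Qed.

Lemma sconj1 : sconj sone = sone :> alg R k.
Proof. by case: k; alg_coord; ring. Qed.

Lemma sconjK x : sconj (sconj x) = x.
Proof. by case: k x => x; alg_coord; ring. Qed.

Lemma nrm0 : nrm (0 : alg R k) = 0.
Proof. by apply/eqP; rewrite nrm_eq0. Qed.

(** This is the imaginary component of F F^c for F = a + i b; being a real multiple of [sone], it is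
    central. *)
Lemma smul_sconj_add a b :
  a *a sconj b + b *a sconj a = tr (sconj b *a a) *: sone.
Proof. by case: k a b => a b; alg_coord; ring. Qed.

Lemma trC a b : tr (sconj a *a b) = tr (sconj b *a a).
Proof. by case: k a b => a b; alg_coord; ring. Qed.

Lemma smul1r x : x *a sone = x.
Proof. by case: k x => x; alg_coord; ring. Qed.

(* The two components of F^c (F G) = N(F) G in the alternative algebra A (x) C. *)
Lemma stem_conj_mul1 a b c d :
  sconj a *a (a *a c - b *a d) - sconj b *a (a *a d + b *a c)
  = (nrm a - nrm b) *: c - tr (sconj b *a a) *: d.
Proof. by case: k a b c d => a b c d; alg_coord; ring. Qed.

Lemma stem_conj_mul2 a b c d :
  sconj a *a (a *a d + b *a c) + sconj b *a (a *a c - b *a d)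
  = (nrm a - nrm b) *: d + tr (sconj b *a a) *: c.
Proof. by case: k a b c d => a b c d; alg_coord; ring. Qed.

(** Multiplying b^c a + a^c b = t(b^c a) on the right by b^c rewrites b^c a b^c, since (a^c b) b^c =
    n(b) a^c. The outcome is the real component of F^c times the complex conjugate of N(F). *)
Lemma Phi_numE a b :
  nrm a *: sconj a + (sconj b *a a) *a sconj b
  = (nrm a - nrm b) *: sconj a + tr (sconj b *a a) *: sconj b.
Proof. by case: k a b => a b; alg_coord; ring. Qed.
End AlgebraIdentities.

(** * Inversion of F = a + i b in A (x) C *)

Section StemInverse.
Variables (R : realType) (k : alg_kind).
Implicit Types (a b c d : alg R k) (p q r : R).

(* The squared modulus of N(F) = (n(a) - n(b)) + i t(b^c a), for F = a + i b. *)
Definition normal_sq a b : R :=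
  (nrm a - nrm b) ^+ 2 + tr (sconj b *a a) ^+ 2.

Lemma normal_sq_eq0 a b :
  (normal_sq a b == 0) = (nrm a - nrm b == 0) && (tr (sconj b *a a) == 0).
Proof. by rewrite paddr_eq0 ?sqr_ge0 // !sqrf_eq0. Qed.

Lemma normal_sqC a b : normal_sq b a = normal_sq a b.
Proof. by rewrite /normal_sq trC; ring. Qed.

Lemma Phi_dom_normal_sq a b : normal_sq a b != 0 -> Phi_dom a b.
Proof.
rewrite normal_sq_eq0 negb_and => /orP[n|t]; [left|by right].
by rewrite -subr_eq0.
Qed.

Lemma PhiE a b : Phi a b = (normal_sq a b)^-1 *:
  ((nrm a - nrm b) *: sconj a + tr (sconj b *a a) *: sconj b).
Proof. by rewrite /Phi Phi_numE. Qed.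

(** Exchanging a and b negates n(a) - n(b) and keeps the trace; this gives the imaginary component
    of N(F)^-1 F^c. *)
Lemma PhiCE a b : - Phi b a = (normal_sq a b)^-1 *:
  ((nrm a - nrm b) *: sconj b - tr (sconj b *a a) *: sconj a).
Proof. by rewrite PhiE normal_sqC trC -scalerN opprD -scaleNr opprB. Qed.

Lemma nrmN a : nrm (- a) = nrm a.
Proof. by rewrite -scaleN1r nrmZ sqrrN expr1n mul1r. Qed.

Lemma trN a : tr (- a) = - tr a.
Proof. by rewrite /tr sconjN -opprD -scaleN1r sreZ mulN1r. Qed.

Lemma normal_sqN a b : normal_sq a (- b) = normal_sq a b.
Proof. by rewrite /normal_sq nrmN sconjN smulNl trN sqrrN. Qed.

(** Each term of the numerator contains b twice or not at all, and the denominator depends on n(b)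
    and a squared trace. With [PhiNl], this parity makes the reciprocal pair a stem. *)
Lemma PhiNr a b : Phi a (- b) = Phi a b.
Proof.
by rewrite !PhiE normal_sqN nrmN sconjN smulNl trN scaleNr scalerN opprK.
Qed.

Lemma PhiNl a b : Phi (- a) b = - Phi a b.
Proof.
rewrite /Phi nrmN sconjN smulNr smulNl trN sqrrN scalerN.
by rewrite -opprD scalerN.
Qed.

Lemma sconj0 : sconj 0 = 0 :> alg R k.
Proof. by rewrite -(scale0r (0 : alg R k)) sconjZ !scale0r. Qed.

Lemma tr0 : tr (0 : alg R k) = 0.
Proof. by rewrite /tr sconj0 addr0 -(scale0r (0 : alg R k)) sreZ mul0r. Qed.

Lemma Phi0r a : Phi a 0 = invA a.
Proof.
rewrite PhiE /normal_sq nrm0 subr0 /invA sconj0 smul0l tr0 scale0r expr0n !addr0.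
(* For [nrm a = 0] both sides vanish, because the inverse of 0 is 0 by convention. *)
rewrite scalerA; have [->|a0] := eqVneq (nrm a) 0; first by rewrite mulr0 invr0.
by rewrite expr2 invfM -mulrA mulVf ?mulr1.
Qed.

(** Multiplying (p + i q)(c + i d) by p - i q; with p + i q = N(F) this allows division by the
    central factor. *)
Lemma rotate_sum1 p q c d :
  p *: (p *: c - q *: d) + q *: (p *: d + q *: c) = (p ^+ 2 + q ^+ 2) *: c.
Proof. by case: k c d => c d; alg_coord; ring. Qed.

Lemma rotate_sum2 p q c d :
  p *: (p *: d + q *: c) - q *: (p *: c - q *: d) = (p ^+ 2 + q ^+ 2) *: d.
Proof. by case: k c d => c d; alg_coord; ring. Qed.

Lemma stem_inverse_unique a b c d : normal_sq a b != 0 ->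
  a *a c - b *a d = sone -> a *a d + b *a c = 0 ->
  c = Phi a b /\ d = - Phi b a.
Proof.
move=> m0 E1 E2.
have := stem_conj_mul1 a b c d; have := stem_conj_mul2 a b c d.
rewrite PhiE PhiCE E1 E2 !smul0r !smul1r add0r subr0; move: m0.
(* The components p, q of N(F) are generalised first, so that substituting the components of N(F) G
   for a^c and b^c leaves them intact. *)
rewrite /normal_sq; move: (nrm a - nrm b) (tr _) => p q m0 -> ->.
by rewrite rotate_sum1 rotate_sum2 !scalerA mulVf ?scale1r.
Qed.

(** These are the components of F ((p - i q) F^c) = (p - i q) N(F). Taking p + i q = N(F) leaves the
    real number |N(F)|^2. *)
Lemma stem_mul_conjr p q a b :
  a *a (p *: sconj a + q *: sconj b) - b *a (p *: sconj b - q *: sconj a)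
    = (p * (nrm a - nrm b) + q * tr (sconj b *a a)) *: sone
  /\ a *a (p *: sconj b - q *: sconj a) + b *a (p *: sconj a + q *: sconj b)
    = (p * tr (sconj b *a a) - q * (nrm a - nrm b)) *: sone.
Proof. by case: k a b => a b; split; alg_coord; ring. Qed.

Lemma stem_mul_conjl p q a b :
  (p *: sconj a + q *: sconj b) *a a - (p *: sconj b - q *: sconj a) *a b
    = (p * (nrm a - nrm b) + q * tr (sconj b *a a)) *: sone
  /\ (p *: sconj a + q *: sconj b) *a b + (p *: sconj b - q *: sconj a) *a a
    = (p * tr (sconj b *a a) - q * (nrm a - nrm b)) *: sone.
Proof. by case: k a b => a b; split; alg_coord; ring. Qed.

Lemma stem_inverser a b : normal_sq a b != 0 ->
  a *a Phi a b - b *a (- Phi b a) = sone /\ a *a (- Phi b a) + b *a Phi a b = 0.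
Proof.
move=> m0; rewrite PhiE PhiCE !smulZr -scalerBr -scalerDr.
have [-> ->] := stem_mul_conjr (nrm a - nrm b) (tr (sconj b *a a)) a b.
by rewrite [tr _ * (nrm _ - _)]mulrC subrr scale0r scaler0 scalerA mulVf ?scale1r.
Qed.

Lemma stem_inversel a b : normal_sq a b != 0 ->
  Phi a b *a a - (- Phi b a) *a b = sone /\ Phi a b *a b + (- Phi b a) *a a = 0.
Proof.
move=> m0; rewrite PhiE PhiCE !smulZl -scalerBr -scalerDr.
have [-> ->] := stem_mul_conjl (nrm a - nrm b) (tr (sconj b *a a)) a b.
by rewrite [tr _ * (nrm _ - _)]mulrC subrr scale0r scaler0 scalerA mulVf ?scale1r.
Qed.

Lemma smul_eq0 a b : a *a b = 0 -> a = 0 \/ b = 0.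
Proof.
move=> ab; have /eqP := nrmM a b; rewrite ab nrm0 eq_sym mulf_eq0 !nrm_eq0.
by case/orP => /eqP; [left|right].
Qed.

Lemma stem_inverse_im_eq0 a b c d :
  a *a c - b *a d = sone -> a *a d + b *a c = 0 -> d = 0 <-> b = 0.
Proof.
have one0 : sone <> 0 :> alg R k by apply/eqP; exact: sone_neq0.
move=> E1 E2; split=> [d0|b0]; move: E1 E2.
  (* If d = 0, then a c = 1 excludes c = 0, so b c = 0 forces b = 0; the converse uses a in the same
     way. *)
  rewrite d0 !smul0r subr0 add0r => E1 /smul_eq0[//|c0].
  by move: E1; rewrite c0 smul0r => /esym/one0.
rewrite b0 !smul0l subr0 addr0 => E1 /smul_eq0[a0|//].
by move: E1; rewrite a0 smul0l => /esym/one0.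
Qed.

End StemInverse.

(** * Slice functions and their stem components *)

Section SliceFunctions.
Variables (R : realType) (k : alg_kind).
Implicit Types (x J : alg R k) (D : set R[i]) (F G : stem_type (alg R k)).
Implicit Types (f g : alg R k -> alg R k) (Om : set (alg R k)).

(** The representative of the sphere through x in the closed upper half plane. *)
Definition plane_pt x : R[i] := (sre x +i* absA (im x))%C.

Lemma plane_pt_polar (r s : R) J : sphere J ->
  plane_pt (r *: sone + s *: J) = (r +i* `|s|)%C.
Proof. by move=> SJ; rewrite /plane_pt; have [-> _ ->] := im_polar r s SJ. Qed.

Lemma circ_polar D x : conj_invariant D -> circ D x ->
  D (plane_pt x) /\
  exists2 J, sphere J & x = sre x *: sone + absA (im x) *: J.
Proof.
move=> cD [al [be [J [SJ Dz ->]]]]; rewrite plane_pt_polar //.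
have [-> _ ->] := im_polar al be SJ.
(* A negative [be] is absorbed by passing to [- be] and [- J], which conjugates the point of D. *)
have [b0|b0] := leP 0 be; first by rewrite ger0_norm //; split=> //; exists J.
rewrite ltr0_norm //; split; first exact: (cD _ Dz).
by exists (- J); [exact: sphereN | rewrite scaleNr scalerN opprK].
Qed.

Lemma circP D x : conj_invariant D -> circ D x <-> D (plane_pt x).
Proof.
move=> cD; split=> [/(circ_polar cD)[]//|Dx].
(* For real x any imaginary unit serves; otherwise the unit is the normalised imaginary part. *)
have [i0|i0] := eqVneq (im x) 0.
  have [J SJ] := sphere_neq0 R k; exists (sre x), 0, J; split=> //.
    by move: Dx; rewrite /plane_pt i0 /absA nrm0 sqrtr0.
  by rewrite scale0r addr0 [LHS]im_sre i0 addr0.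
have n0 : absA (im x) != 0.
  by rewrite sqrtr_eq0 -ltNge lt_def nrm_eq0 i0 nrm_ge0.
exists (sre x), (absA (im x)), ((absA (im x))^-1 *: im x); split=> //.
  rewrite /sphere /= smulZl smulZr scalerA sqr_im scalerN scalerA.
  rewrite -[X in _ * _ * X]sqr_sqrtr ?nrm_ge0 // -/(absA _) expr2 -invfM.
  by rewrite mulVf ?scale1r // mulf_neq0.
by rewrite scalerA mulfV // scale1r -im_sre.
Qed.

Lemma realAP x : realA x <-> im x = 0.
Proof.
split=> [[r ->]|i0]; last by exists (sre x); rewrite [LHS]im_sre i0 addr0.
by rewrite /im sconjZ sconj1 subrr scaler0.
Qed.

Lemma absA_im_eq0 x : (absA (im x) == 0) = (im x == 0).
Proof.
by rewrite -nrm_eq0 /absA sqrtr_eq0; apply/idP/eqP => [n0|->//]; apply/le_anti;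
  rewrite n0 nrm_ge0.
Qed.

Lemma profile_conj_invariant Om : circular Om -> conj_invariant (profile Om).
Proof. by case=> D [_ cD ->]; rewrite profile_circ. Qed.

Lemma circ_profile Om : circular Om -> Om = circ (profile Om).
Proof. by case=> D [_ cD ->]; rewrite profile_circ. Qed.

Lemma slice_circ D F f : D !=set0 -> conj_invariant D -> corresponds D F f ->
  slice (circ D) f.
Proof.
move=> D0 cD Ff; split; first by exists D.
by exists F; rewrite profile_circ.
Qed.

Lemma corresponds_sub D D' F f : D' `<=` D -> corresponds D F f ->
  corresponds D' F f.
Proof.
move=> DD [sF Ff]; split=> [z /DD/sF//|al be J SJ /DD]; exact: Ff.
Qed.

Lemma corresponds_eq D F G f g : (forall z, D z -> F.1 z = G.1 z /\ F.2 z = G.2 z) ->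
  is_stem D G -> (forall x, circ D x -> f x = g x) ->
  corresponds D F f -> corresponds D G g.
Proof.
move=> FG sG fg [_ Ff]; split=> // al be J SJ Dz.
by have [<- <-] := FG _ Dz; rewrite -Ff // fg //; exists al, be, J.
Qed.

Lemma is_stem_mul D F G : is_stem D F -> is_stem D G -> is_stem D (stem_mul F G).
Proof.
move=> sF sG z Dz; have [F1 F2] := sF z Dz; have [G1 G2] := sG z Dz.
rewrite /= F1 F2 G1 G2 smulNl smulNr opprK; split=> //.
by rewrite smulNr smulNl opprD.
Qed.

Lemma is_stem_conj D F : is_stem D F -> is_stem D (stem_conj F).
Proof. by move=> sF z /sF[/= -> ->]; rewrite sconjN. Qed.

(** The slice product is computed from chosen stems; by uniqueness of stems on D, they agree there
    with the given F and G. *)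
Lemma slice_mulP D F G f g : D !=set0 -> conj_invariant D ->
  corresponds D F f -> corresponds D G g ->
  corresponds D (stem_mul F G) (slice_mul (circ D) f g).
Proof.
move=> D0 cD Ff Gg.
have := stemP (slice_circ D0 cD Ff); have := stemP (slice_circ D0 cD Gg).
rewrite profile_circ // => SG SF.
apply: (corresponds_eq _ _ _ (induceP (is_stem_mul SF.1 SG.1))) => //; last first.
  exact: is_stem_mul Ff.1 Gg.1.
move=> z Dz; rewrite /=.
have [-> ->] := corresponds_inj cD SF Ff Dz.
by have [-> ->] := corresponds_inj cD SG Gg Dz.
Qed.

Lemma slice_conjP D F f : D !=set0 -> conj_invariant D ->
  corresponds D F f ->
  corresponds D (stem_conj F) (slice_conj (circ D) f).
Proof.
move=> D0 cD Ff; have := stemP (slice_circ D0 cD Ff); rewrite profile_circ // => SF.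
apply: (corresponds_eq _ _ _ (induceP (is_stem_conj SF.1))) => //; last first.
  exact: is_stem_conj Ff.1.
by move=> z Dz /=; have [-> ->] := corresponds_inj cD SF Ff Dz.
Qed.

Lemma corresponds_cst1 D : corresponds D (fun=> sone, fun=> 0) (fun _ : alg R k => sone).
Proof. by split=> [z _|al be J _ _] /=; rewrite ?oppr0 // smul0r addr0. Qed.

Lemma corresponds_value D F f x J : corresponds D F f -> D (plane_pt x) ->
  sphere J -> x = sre x *: sone + absA (im x) *: J ->
  f x = F.1 (plane_pt x) + J *a F.2 (plane_pt x).
Proof. by move=> [_ Ff] Dx SJ xE; rewrite [in LHS]xE Ff. Qed.

Lemma sconj_im x : sconj x = sre x *: sone - im x.
Proof. by rewrite {1}[x]im_sre; case: k x => x; alg_coord; field. Qed.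

Lemma corresponds_real D F f x : corresponds D F f -> D (plane_pt x) ->
  realA x -> [/\ f x = F.1 (plane_pt x), sph_value f x = F.1 (plane_pt x)
    & F.2 (plane_pt x) = 0].
Proof.
move=> Ff Dx /realAP i0; have [J SJ] := sphere_neq0 R k.
(* On the real axis the plane point is its own conjugate, so the odd component vanishes. *)
have F0 : F.2 (plane_pt x) = 0.
  have zE : conjc (plane_pt x) = plane_pt x.
    by rewrite /plane_pt i0 /absA nrm0 sqrtr0 /= oppr0.
  have [_] := Ff.1 _ Dx; rewrite zE.
  move/eqP; rewrite -addr_eq0 -mulr2n -scaler_nat scaler_eq0 pnatr_eq0 /=.
  by move/eqP.
have fx : f x = F.1 (plane_pt x).
  rewrite (corresponds_value Ff Dx SJ) ?F0 ?smul0r ?addr0 //.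
  by rewrite i0 /absA nrm0 sqrtr0 scale0r addr0 {1}[x]im_sre i0 addr0.
have xE : sconj x = x by rewrite sconj_im i0 subr0 [RHS]im_sre i0 addr0.
split=> //; rewrite /sph_value xE fx -mulr2n -scaler_nat scalerA mulVf ?scale1r //.
by rewrite pnatr_eq0.
Qed.

(** Since x and x^c have the same plane point and opposite units J and -J, half the sum and half the
    difference of the two values of f isolate F1 and J F2. *)
Lemma corresponds_sph D F f x : conj_invariant D -> corresponds D F f ->
  D (plane_pt x) -> ~ realA x ->
  let J := (absA (im x))^-1 *: im x in
  [/\ sphere J, f x = F.1 (plane_pt x) + J *a F.2 (plane_pt x),
      sph_value f x = F.1 (plane_pt x),
      absA (im x) *: sph_deriv f x = F.2 (plane_pt x)
    & im x *a sph_deriv f x = J *a F.2 (plane_pt x)].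
Proof.
move=> cD Ff Dx xR J.
have i0 : im x != 0 by apply/eqP => /realAP.
have n0 : absA (im x) != 0 by rewrite absA_im_eq0.
have imE : im x = absA (im x) *: J by rewrite scalerA mulfV // scale1r.
have SJ : sphere J.
  (* Comparing imaginary parts with a polar form of x identifies J with its unit K. *)
  have /(circ_polar cD)[_ [K SK]] : circ D x by apply/circP.
  rewrite {1}[x]im_sre => /addrI.
  by rewrite {1}imE => /(scalerI n0) ->.
have fx : f x = F.1 (plane_pt x) + J *a F.2 (plane_pt x).
  by apply: corresponds_value Ff Dx SJ _; rewrite -imE -im_sre.
have fcx : f (sconj x) = F.1 (plane_pt x) - J *a F.2 (plane_pt x).
  rewrite sconj_im imE -scalerN; case: Ff => _ -> //; last exact: sphereN.
  by rewrite smulNl.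
have half (y : alg R k) : 2^-1 *: (y + y) = y.
  by rewrite -mulr2n -scaler_nat scalerA mulVf ?scale1r // pnatr_eq0.
have dE : absA (im x) *: sph_deriv f x = F.2 (plane_pt x).
  rewrite /sph_deriv.
  have -> : f x - f (sconj x) = J *a F.2 (plane_pt x) + J *a F.2 (plane_pt x).
    by rewrite fx fcx opprB [X in _ + X]addrC addrACA subrr add0r.
  rewrite smulDr half.
  have -> : invA (im x) = (absA (im x))^-1 *: - J.
    rewrite /invA; have -> : sconj (im x) = - (absA (im x) *: J).
      by rewrite -imE /im sconjZ sconjD sconjN sconjK -scalerN opprB.
    rewrite -scalerN scalerA; congr (_ *: _).
    rewrite -[nrm _]sqr_sqrtr ?nrm_ge0 // -/(absA _) expr2 invfM -mulrA.
    by rewrite mulVf ?mulr1.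
  (* Left alternativity gives (-J)(J F2) = -(J J) F2 = F2 without associativity. *)
  rewrite smulZl scalerA mulfV // scale1r smulNl smul_altl.
  by rewrite (SJ : _ = _) smulNl smul1l opprK.
split=> //; first by rewrite /sph_value fx fcx addrACA subrr addr0 half.
by rewrite {1}imE smulZl -smulZr dE.
Qed.

End SliceFunctions.

(** * The reciprocal and its domain *)

Section Reciprocal.
Variables (R : realType) (k : alg_kind).
Implicit Types (x J : alg R k) (D : set R[i]) (F G : stem_type (alg R k)).
Implicit Types (f g : alg R k -> alg R k).

Definition stem_reciprocal F : stem_type (alg R k) :=
  (fun z => Phi (F.1 z) (F.2 z), fun z => - Phi (F.2 z) (F.1 z)).

Definition regular_points D F : set R[i] :=
  [set z | D z /\ normal_sq (F.1 z) (F.2 z) != 0].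

Lemma regular_points_conj_invariant D F : conj_invariant D -> is_stem D F ->
  conj_invariant (regular_points D F).
Proof.
move=> cD sF z [Dz z0]; split; first exact: cD.
by have [-> ->] := sF z Dz; rewrite normal_sqN.
Qed.

Lemma is_stem_reciprocal D F : is_stem D F -> is_stem D (stem_reciprocal F).
Proof. by move=> sF z /sF[/= -> ->]; rewrite PhiNr PhiNl. Qed.

(** The value of N(f) at x is p + q J with p, q real, where p + i q = N(F). Its real part is p and
    its imaginary part has modulus |q|, so it vanishes exactly when p = q = 0. *)
Lemma normal_eq0 D F f x : D !=set0 -> conj_invariant D -> corresponds D F f ->
  D (plane_pt x) -> normal (circ D) f x = 0 <->
  normal_sq (F.1 (plane_pt x)) (F.2 (plane_pt x)) = 0.
Proof.
move=> D0 cD Ff Dx.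
have /(circ_polar cD)[_ [J SJ xE]] : circ D x by apply/circP.
have NP := slice_mulP D0 cD Ff (slice_conjP D0 cD Ff).
rewrite /normal (corresponds_value NP Dx SJ xE) /= !mul_sconj -scalerBl.
rewrite smul_sconj_add smulZr smul1r.
set p := nrm _ - nrm _; set q := tr _.
split=> [E|/eqP]; last first.
  by rewrite normal_sq_eq0 -/p -/q => /andP[/eqP -> /eqP ->]; rewrite !scale0r addr0.
have im0 : im (0 : alg R k) = 0 by rewrite /im sconj0 subr0 scaler0.
have [] := im_polar p q SJ; rewrite E im0 /absA nrm0 sqrtr0.
rewrite -(scale0r (0 : alg R k)) sreZ mul0r => p0 _ /esym/normr0_eq0 q0.
by rewrite /normal_sq -/p -/q -p0 q0 !expr0n addr0.
Qed.

Lemma regular_circ D F f : D !=set0 -> conj_invariant D -> corresponds D F f ->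
  circ D `\` zeros (circ D) (normal (circ D) f) = circ (regular_points D F).
Proof.
move=> D0 cD Ff; have cD' := regular_points_conj_invariant cD Ff.1.
apply/seteqP; split=> x /=.
  move=> [/(circP _ cD) Dx nz]; apply/(circP _ cD'); split=> //.
  apply/eqP => /(normal_eq0 D0 cD Ff Dx) z; apply: nz; split=> //.
  exact/(circP _ cD).
move=> /(circP _ cD')[Dx /eqP nz]; split; first exact/(circP _ cD).
by move=> [_ /(normal_eq0 D0 cD Ff Dx)].
Qed.

Lemma slice_inverse_exists D F f : D !=set0 -> conj_invariant D ->
  corresponds D F f ->
  (forall z, D z -> normal_sq (F.1 z) (F.2 z) != 0) ->
  slice_inverse (circ D) f (induce (stem_reciprocal F)).
Proof.
move=> D0 cD Ff nz; have Gg := induceP (is_stem_reciprocal Ff.1).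
split=> [|x /(circ_polar cD)[Dx [J SJ xE]]]; first exact: slice_circ D0 cD Gg.
have FG := slice_mulP D0 cD Ff Gg; have GF := slice_mulP D0 cD Gg Ff.
rewrite (corresponds_value FG Dx SJ xE) (corresponds_value GF Dx SJ xE) /=.
have [-> ->] := stem_inverser (nz _ Dx); have [-> ->] := stem_inversel (nz _ Dx).
by rewrite smul0r addr0.
Qed.

(** The product f g agrees with the constant 1 on the circular set, so uniqueness of stems turns
    this into F G = 1 at each point of D. *)
Lemma slice_inverse_stem D F f g : D !=set0 -> conj_invariant D ->
  corresponds D F f -> slice_inverse (circ D) f g ->
  exists2 G, corresponds D G g & forall z, D z ->
    F.1 z *a G.1 z - F.2 z *a G.2 z = sone /\
    F.1 z *a G.2 z + F.2 z *a G.1 z = 0.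
Proof.
move=> D0 cD Ff [/stemP]; rewrite profile_circ // => Gg fg.
exists (stem (circ D) g) => // z Dz.
have FG := slice_mulP D0 cD Ff Gg.
have one : corresponds D (fun=> sone, fun=> 0) (slice_mul (circ D) f g).
  have c1 := corresponds_cst1 k D.
  by apply: (corresponds_eq _ c1.1 _ c1) => // x /fg[->].
exact: (corresponds_inj cD FG one Dz).
Qed.
End Reciprocal.

Theorem theorem4p4 (R : realType) (k : alg_kind) (Om : set (alg R k))
    (f : alg R k -> alg R k) (Om' : set (alg R k)) :
  circular Om ->
  slice Om f ->
  Om' = Om `\` zeros Om (normal Om f) ->
  Om' !=set0 ->
  (exists g, slice_inverse Om' f g) /\
  forall g : alg R k -> alg R k, slice_inverse Om' f g ->
  [/\ (forall x, Om' x -> ~ realA x ->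
         let a := sph_value f x in
         let b := absA (im x) *: sph_deriv f x in
         let J := (absA (im x))^-1 *: im x in
         [/\ Phi_dom a b /\ Phi_dom b a,
             g x = Phi a b - J *a Phi b a,
             Phi a b = sph_value g x
           & - (J *a Phi b a) = im x *a sph_deriv g x]),
      (forall x, (Om' `&` (realA `|`
                           zeros (Om `\` realA) (sph_deriv f))) x ->
         [/\ sph_value f x != 0, f x != 0,
             g x = invA (sph_value f x) & g x = invA (f x)])
    & zeros (Om' `\` realA) (sph_deriv g)
      = zeros (Om `\` realA) (sph_deriv f) `&` Om'].
Proof.
move=> cOm sf Om'E Om'0.
set D := profile Om; set F := stem Om f.
have cD : conj_invariant D := profile_conj_invariant cOm.
have OmE : Om = circ D := circ_profile cOm.
have D0 : D !=set0.
  by case: Om'0 => x; rewrite Om'E OmE => -[/(circP _ cD) Dx _]; exists (plane_pt x).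
have Ff : corresponds D F f := stemP sf.
set D' := regular_points D F.
have cD' : conj_invariant D' := regular_points_conj_invariant cD Ff.1.
(* [Om'] is circular with plane set [D'], so all results on slice functions apply over [D']. *)
have {Om'E} Om'E : Om' = circ D' by rewrite Om'E OmE (regular_circ D0 cD Ff).
have D'0 : D' !=set0.
  by case: Om'0 => x; rewrite Om'E => /(circP _ cD') Dx; exists (plane_pt x).
have Ff' : corresponds D' F f by apply: corresponds_sub Ff => z [].
have inOm' x : Om' x <-> D' (plane_pt x) by rewrite Om'E; apply: circP.
split.
  exists (induce (stem_reciprocal F)); rewrite Om'E.
  by apply: slice_inverse_exists => // z [].
move=> g; rewrite {1}Om'E => /(slice_inverse_stem D'0 cD' Ff')[G Gg FG].
have GE z : D' z -> G.1 z = Phi (F.1 z) (F.2 z) /\ G.2 z = - Phi (F.2 z) (F.1 z).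
  by move=> Dz; have [E1 E2] := FG z Dz; apply: stem_inverse_unique E1 E2; case: Dz.
(* Off the real axis the stem component is the spherical derivative times the nonzero factor |im
   x|. *)
have dG0 x : Om' x -> ~ realA x -> (sph_deriv f x = 0 <-> F.2 (plane_pt x) = 0) /\
    (sph_deriv g x = 0 <-> G.2 (plane_pt x) = 0).
  move=> /inOm' Dx xR.
  have n0 : absA (im x) != 0 by rewrite absA_im_eq0; apply/eqP => /realAP.
  have [_ _ _ <- _] := corresponds_sph cD' Ff' Dx xR.
  have [_ _ _ <- _] := corresponds_sph cD' Gg Dx xR.
  by split; split=> [->|/eqP]; rewrite ?scaler0 // scaler_eq0 (negPf n0) => /eqP.
split.
- move=> x /inOm' Dx xR a b J.
  have [SJ _ aE bE _] := corresponds_sph cD' Ff' Dx xR.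
  have [_ gx gv _ gd] := corresponds_sph cD' Gg Dx xR.
  have [G1 G2] := GE _ Dx; have [_ nz] := Dx.
  rewrite gx gv gd /a /b aE bE G1 G2 /J smulNr; split=> //.
  by split; apply: Phi_dom_normal_sq => //; rewrite normal_sqC.
- move=> x [/inOm' Dx xV]; have [G1 G2] := GE _ Dx; have [_ nz] := Dx.
  (* Both cases reduce to F2 = 0: by parity on the real axis, and by [dG0] on the zeros of the
     spherical derivative, where G2 = 0 follows from F G = 1. *)
  have [F20 fx fs gx] : [/\ F.2 (plane_pt x) = 0, f x = F.1 (plane_pt x),
      sph_value f x = F.1 (plane_pt x) & g x = G.1 (plane_pt x)].
    have [xR|xR] := pselect (realA x).
      have [-> -> ->] := corresponds_real Ff' Dx xR.
      by have [-> _ _] := corresponds_real Gg Dx xR.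
    case: xV => // -[_ d0].
    have F20 : F.2 (plane_pt x) = 0 by apply/(dG0 x _ xR).1 => //; apply/inOm'.
    have G20 : G.2 (plane_pt x) = 0.
      have [E1 E2] := FG _ Dx; exact/(stem_inverse_im_eq0 E1 E2).
    have [_ -> -> _ _] := corresponds_sph cD' Ff' Dx xR.
    have [_ -> _ _ _] := corresponds_sph cD' Gg Dx xR.
    by rewrite F20 G20 !smul0r !addr0.
  (* Now G1 = Phi(F1, 0) is the inverse of F1, and regularity excludes F1 = 0. *)
  move: nz; rewrite fx fs gx G1 F20 Phi0r => nz; suff : F.1 (plane_pt x) != 0 by [].
  by apply: contra nz => /eqP ->; rewrite /normal_sq nrm0 smul0r tr0 subr0 expr0n addr0.
(* Both inclusions pass through the equivalence of F2 = 0 and G2 = 0 at the plane point. *)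
- apply/seteqP; split=> x /=.
    move=> [[Ox xR] g0]; split=> //; split.
      by split=> //; move/inOm': Ox => [Dx _]; rewrite OmE; apply/circP.
    have [E1 E2] := FG _ ((inOm' x).1 Ox); apply/(dG0 x Ox xR).1.
    by apply/(stem_inverse_im_eq0 E1 E2); apply/(dG0 x Ox xR).2.
  move=> [[[_ xR] f0] Ox]; split=> //.
  have [E1 E2] := FG _ ((inOm' x).1 Ox); apply/(dG0 x Ox xR).2.
  by apply/(stem_inverse_im_eq0 E1 E2); apply/(dG0 x Ox xR).1.
Qed.
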